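(* Let $T$ be the Tietze graph, i.e. the graph with vertex set $\{1,\dots,12\}$ and edge set $\{1,2\},\{2,3\},\{3,4\},\{4,5\},\{5,6\},\{6,7\},\{7,8\},\{8,9\},\{1,9\},\{1,10\},\{4,11\},\{7,12\},\{3,8\},\{2,6\},\{5,9\},\{10,11\},\{11,12\},\{10,12\}$. A $T$ design of order $n$ exists if and only if $n \equiv 1$ or $28 \pmod{36}$.
   Context: All graphs are simple. For a graph $G$, a $G$ design of order $n$ is a partition of the edge set of the complete graph $K_n$ into edge sets of subgraphs each isomorphic to $G$. By convention the empty set is a $G$ design of order $1$. *)

(* Defs.v *)
From mathcomp Require Import all_boot.

Set Implicit Arguments.
Unset Strict Implicit.
Unset Printing Implicit Defensive.

(* A simple graph whose vertices form a finite subset of an ambient finite type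
   [T]; an edge is a two-element set of vertices.  Elements of [T] outside
   [vertices] are not part of the graph. *)
Record graph (T : finType) := Graph {
  vertices : {set T};
  edges : {set {set T}};
  edgesP : forall e, e \in edges -> e \subset vertices /\ #|e| = 2
}.

Definition subgraph (T : finType) (H G : graph T) : Prop :=
  vertices H \subset vertices G /\ edges H \subset edges G.

(* [f] is total on the ambient type; only its values on [vertices G] matter. *)
Definition isomorphic (T U : finType) (G : graph T) (H : graph U) : Prop :=
  exists f : T -> U,
    [/\ {in vertices G &, injective f},
        f @: vertices G = vertices H &
        {in vertices G &, forall x y,
           ([set f x; f y] \in edges H) = ([set x; y] \in edges G)}].

Lemma complete_edgesP n (e : {set 'I_n}) :
  e \in [set e : {set 'I_n} | #|e| == 2] -> e \subset [set: 'I_n] /\ #|e| = 2.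
Proof. by rewrite inE => /eqP ->; rewrite subsetT. Qed.

Definition complete (n : nat) : graph 'I_n := Graph (@complete_edgesP n).

(* For n = 1 (and n = 0) the empty set is a design. *)
Definition is_design (T : finType) (G : graph T) (n : nat)
    (D : {set {set {set 'I_n}}}) : Prop :=
  partition D (edges (complete n)) /\
  forall B, B \in D -> exists H : graph 'I_n,
    [/\ subgraph H (complete n), isomorphic G H & edges H = B].

Definition tietze_edge_list : seq (nat * nat) :=
  [:: (1, 2); (2, 3); (3, 4); (4, 5); (5, 6); (6, 7); (7, 8); (8, 9); (1, 9);
      (1, 10); (4, 11); (7, 12); (3, 8); (2, 6); (5, 9);
      (10, 11); (11, 12); (10, 12)].

(* The vertex set is {1, ..., 12} inside 'I_13; the element 0 of 'I_13 is not
   a vertex. *)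
Definition tietze_vertices : {set 'I_13} := [set i : 'I_13 | 0 < i].

Definition tietze_edges : {set {set 'I_13}} :=
  [set e in [seq [set inord p.1; inord p.2] | p <- tietze_edge_list]].

Lemma tietze_edgesP (e : {set 'I_13}) :
  e \in tietze_edges -> e \subset tietze_vertices /\ #|e| = 2.
Proof.
rewrite inE => /mapP[p p_in ->].
have /allP/(_ p p_in)/and5P[p1 p1' p2 p2' p12] :
  all (fun p => [&& 0 < p.1, p.1 < 13, 0 < p.2, p.2 < 13 & p.1 != p.2])
      tietze_edge_list by [].
split; first by rewrite subUset !sub1set !inE !inordK ?p1.
by rewrite cards2 -val_eqE /= !inordK // p12.
Qed.

Definition tietze : graph 'I_13 := Graph tietze_edgesP.

(* Main.v *)
Require Import Defs.
From mathcomp Require Import all_boot.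
From mathcomp Require Import zify.

Set Implicit Arguments.
Unset Strict Implicit.
Unset Printing Implicit Defensive.

(** Necessity: the 18 edges of a block and the degree 3 of its vertices give
    [36 | n (n - 1)] and [3 | n - 1].

    Sufficiency: let [v] be odd and take a point at infinity together with [v]
    groups, each made of three levels of 12 points, except that the levels of
    group 0 have [a] points, where [a] is 9, 12, 21 or 24; this gives
    [36 (v - 1) + 3 a + 1] points, hence every admissible order greater than 1.
    Two levels in different groups lie together in exactly one of Bose's triples
    [(x, i), (y, i), ((x + y) / 2, i + 1)], with [x <> y] modulo [v] and [i] modulo 3.
    So the edges between groups are covered by copies of [K_{12,12,12}] and
    [K_{12,12,a}], and the edges within a group and to infinity by [K_37] and
    [K_{3a+1}].  Decompositions of these graphs into Tietze graphs were found by
    computer search under a prescribed cyclic automorphism group. *)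

(** * Decompositions into Tietze graphs as multiplicities of arcs *)

Definition tietze_arcs : seq (nat * nat) :=
  tietze_edge_list ++ [seq (p.2, p.1) | p <- tietze_edge_list].

(* A block is the image of a labelling [b] of the Tietze graph; only its values
   on 1, ..., 12 matter. *)
Definition arcs (V : Type) (b : nat -> V) : seq (V * V) :=
  [seq (b p.1, b p.2) | p <- tietze_arcs].

Definition embedding (V : eqType) (b : nat -> V) : bool :=
  uniq [seq b k | k <- iota 1 12].

(** Counting arcs in both directions turns covering and disjointness into one numerical equation, so
    that decompositions can be added and transported without handling sets of edges. *)
Definition decomposable (V : eqType) (E : V -> V -> nat) : Prop :=
  exists s : seq (nat -> V), all (@embedding V) s /\
    forall x y, \sum_(b <- s) count_mem (x, y) (arcs b) = E x y.

Lemma tietze_arcs_range p :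
  p \in tietze_arcs -> (p.1 \in iota 1 12) && (p.2 \in iota 1 12).
Proof. by move: p; apply/allP. Qed.

Lemma tietze_arcs_cover k :
  k \in iota 1 12 -> exists2 p, p \in tietze_arcs & p.1 = k.
Proof.
move=> kin; have /allP/(_ k kin)/hasP[p pin /eqP pk] :
  all (fun k => has (fun p => p.1 == k) tietze_arcs) (iota 1 12) by [].
by exists p.
Qed.

Lemma embedding_inj (V : eqType) (b : nat -> V) :
  embedding b -> {in iota 1 12 &, injective b}.
Proof.
rewrite /embedding => ub i j iin jin eqb.
have := uniqP (b 0) ub; rewrite size_map size_iota => H.
have ok k : k \in iota 1 12 -> (k.-1 < 12) /\ b k = nth (b 0) [seq b k | k <- iota 1 12] k.-1.
  rewrite mem_iota => kin; have kl : k.-1 < 12 by lia.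
  by split=> //; rewrite (nth_map 0) ?size_iota // nth_iota //; congr b; lia.
have [il iE] := ok i iin; have [jl jE] := ok j jin.
have := H i.-1 j.-1 il jl; rewrite -iE -jE => /(_ eqb).
by move: iin jin; rewrite !mem_iota; lia.
Qed.

Lemma arcsP (V : eqType) (b : nat -> V) x y :
  reflect (exists2 p, p \in tietze_arcs & x = b p.1 /\ y = b p.2)
          ((x, y) \in arcs b).
Proof.
apply: (iffP mapP) => [[p pin [-> ->]]|[p pin [-> ->]]]; by exists p.
Qed.

Lemma eq_decomposable (V : eqType) (E E' : V -> V -> nat) :
  (forall x y, E x y = E' x y) -> decomposable E -> decomposable E'.
Proof. by move=> eqE [s [sok sE]]; exists s; split=> // x y; rewrite sE eqE. Qed.

Lemma decomposable0 (V : eqType) : decomposable (fun _ _ : V => 0).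
Proof. by exists [::]; split=> // x y; rewrite big_nil. Qed.

Lemma decomposableD (V : eqType) (E E' : V -> V -> nat) :
  decomposable E -> decomposable E' ->
  decomposable (fun x y => E x y + E' x y).
Proof.
move=> [s [sok sE]] [s' [sok' sE']]; exists (s ++ s'); split=> [|x y].
  by rewrite all_cat sok.
by rewrite big_cat /= sE sE'.
Qed.

Lemma decomposable_sum (V : eqType) (I : Type) (r : seq I) (P : pred I)
    (E : I -> V -> V -> nat) :
  (forall i, P i -> decomposable (E i)) ->
  decomposable (fun x y => \sum_(i <- r | P i) E i x y).
Proof.
move=> dE; elim: r => [|i r IH].
  by apply: eq_decomposable (decomposable0 V) => x y; rewrite big_nil.
case Pi: (P i).
  by apply: eq_decomposable (decomposableD (dE i Pi) IH) => x y; rewrite big_cons Pi.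
by apply: eq_decomposable IH => x y; rewrite big_cons Pi.
Qed.

(** The Tietze graph has no isolated vertex, so each label of a block is the end of one of its
    arcs. *)
Lemma blocks_in_support (V : eqType) (D : pred V) (s : seq (nat -> V)) :
  (forall x y, \sum_(b <- s) count_mem (x, y) (arcs b) != 0 -> D x && D y) ->
  all (fun b => all (preim b D) (iota 1 12)) s.
Proof.
elim: s => [//|b s IH] sD; apply/andP; split.
  apply/allP => k /tietze_arcs_cover[p pin <-].
  suff /sD/andP[] : \sum_(c <- b :: s) count_mem (b p.1, b p.2) (arcs c) != 0 by [].
  rewrite big_cons -lt0n addn_gt0 -has_count has_pred1.
  by apply/orP; left; apply/arcsP; exists p.
by apply: IH => x y nz; apply: sD; rewrite big_cons; lia.
Qed.

Lemma arcs_comp (V W : Type) (f : V -> W) (b : nat -> V) :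
  arcs (f \o b) = [seq (f a.1, f a.2) | a <- arcs b].
Proof. by rewrite /arcs -map_comp. Qed.

(** Renaming of vertices. Injectivity on [D] suffices because the labels of all blocks lie in the
    support of [E], hence in [D]. *)
Lemma decomposable_map (V W : eqType) (f : V -> W) (D : pred V)
    (E : V -> V -> nat) (E' : W -> W -> nat) :
  {in D &, injective f} ->
  (forall u v, E u v != 0 -> D u && D v) ->
  (forall u v, D u -> D v -> E' (f u) (f v) = E u v) ->
  (forall x y, E' x y != 0 ->
     exists u v, [/\ D u, D v, x = f u & y = f v]) ->
  decomposable E -> decomposable E'.
Proof.
move=> finj ED E'E E'D [s [sok sE]].
have inD : all (fun b => all (preim b D) (iota 1 12)) s.
  by apply: blocks_in_support => x y; rewrite sE; apply: ED.
exists [seq f \o b | b <- s]; split.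
  elim: s sok inD {sE} => [//|b s IH] /andP[bok sok] /andP[bD sD].
  rewrite map_cons; apply/andP; split; last exact: IH.
  rewrite /embedding (map_comp f b) map_inj_in_uniq // => u v.
  move=> /mapP[k kin ->] /mapP[l lin ->]; apply: finj.
    exact: (allP bD).
  exact: (allP bD).
have arcD (b : nat -> V) a : all (preim b D) (iota 1 12) -> a \in arcs b -> D a.1 && D a.2.
  move=> bD /mapP[p /tietze_arcs_range/andP[p1 p2] ->].
  by apply/andP; split; apply: (allP bD).
have fcount u v : D u -> D v ->
    \sum_(b <- [seq f \o b | b <- s]) count_mem (f u, f v) (arcs b) = E u v.
  move=> Du Dv; rewrite -sE big_map.
  elim: s inD {sok sE} => [|b s IH]; first by rewrite !big_nil.
  move=> /andP[bD sD]; rewrite !big_cons IH //; congr addn.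
  rewrite arcs_comp count_map; apply: eq_in_count => a /(arcD _ _ bD)/andP[a1 a2] /=.
  rewrite !xpair_eqE; case: a a1 a2 => a1 a2 /= Da1 Da2; rewrite xpair_eqE.
  by rewrite !(inj_in_eq finj).
move=> x y; case: (boolP (E' x y == 0)) => [/eqP E0|/E'D[u [v [Du Dv -> ->]]]]; last first.
  by rewrite fcount // E'E.
(* A nonzero count at [x], [y] would put both in the image of [D], where the count is known to equal
   [E']. *)
apply/eqP; rewrite E0; apply: contraT => nz.
have [u [v [Du Dv xE yE]]] : exists u v, [/\ D u, D v, x = f u & y = f v].
  elim: s inD nz {sok sE fcount} => [|b s IH]; first by rewrite big_nil.
  move=> /andP[bD sD]; rewrite map_cons big_cons -lt0n addn_gt0 => /orP[|]; last first.
    by rewrite lt0n; apply: IH.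
  rewrite -has_count has_pred1 arcs_comp => /mapP[a /(arcD _ _ bD)/andP[a1 a2] [-> ->]].
  by exists a.1, a.2.
by move: nz; rewrite xE yE fcount // -E'E // -xE -yE E0.
Qed.

(** * Explicit decompositions, verified by computation *)

(** A test made for [vm_compute]: the arcs out of [x] are extracted once, before all [y] are
    counted. The 0 in front of [l] fills index 0, so that the twelve entries of [l] label the
    vertices 1, ..., 12. *)
Definition covers (N : nat) (E : rel nat) (L : seq (seq nat)) : bool :=
  let A := flatten [seq arcs (nth 0 (0 :: l)) | l <- L] in
  [&& all (fun l => (size l == 12) && uniq l) L,
      all (fun a => (a.1 < N) && (a.2 < N)) A &
      all (fun x => let r := [seq a.2 | a <- A & a.1 == x] in
             all (fun y => count_mem y r == E x y) (iota 0 N)) (iota 0 N)].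

Lemma covers_decomposable N (E : rel nat) (L : seq (seq nat)) :
  covers N E L -> decomposable (fun x y => [&& x < N, y < N & E x y] : nat).
Proof.
case/and3P => Lok AN AE; exists [seq nth 0 (0 :: l) | l <- L]; split.
  rewrite all_map; apply: sub_all Lok => l /andP[/eqP sl ul].
  rewrite /= /embedding -[iota 1 12]/(map succn (iota 0 12)) -map_comp.
  by rewrite (eq_map (_ : _ =1 nth 0 l)) // -sl map_nth_iota0 ?take_size.
move=> x y; set A := flatten _ in AN AE.
have -> : \sum_(b <- [seq nth 0 (0 :: l) | l <- L]) count_mem (x, y) (arcs b) =
          count_mem (x, y) A.
  by rewrite /A count_flatten sumnE !big_map.
case: (boolP ((x < N) && (y < N))) => [/andP[xN yN]|out].
  have := allP AE x; rewrite mem_iota => /(_ xN)/allP/(_ y).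
  rewrite mem_iota => /(_ yN)/eqP; rewrite xN yN /= => <-.
  by rewrite count_map count_filter; apply: eq_count => -[u v]; rewrite /= xpair_eqE andbC.
have -> : [&& x < N, y < N & E x y] = false by move: out; case: (x < N) (y < N) => [] [].
by apply/count_memPn/negP => /(allP AN) /=; rewrite (negPf out).
Qed.

(** A pair [(s, l)] in [cs] stands for the cyclic shift of the interval of length [l] starting at
    [s]; the product of these cycles is the prescribed automorphism. *)
Definition rotate (cs : seq (nat * nat)) (x : nat) : nat :=
  foldr (fun c y => if c.1 <= x < c.1 + c.2 then c.1 + (x - c.1).+1 %% c.2 else y)
        x cs.

Definition develop (cs : seq (nat * nat)) (m : nat) (L : seq (seq nat)) :=
  flatten [seq [seq map (iter k (rotate cs)) l | l <- L] | k <- iota 0 m].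

Definition complete_rel : rel nat := fun x y => x != y.

(* The first two parts of the tripartite graph are the even and the odd numbers
   below 24. *)
Definition part (x : nat) : nat := if x < 24 then odd x : nat else 2.
Definition tripartite_rel : rel nat := fun x y => part x != part y.

Definition complete28_blocks : seq (seq nat) :=
  develop [:: (0, 7); (7, 7); (14, 7); (21, 7)] 7
    [:: [:: 8; 21; 15; 18; 11; 26; 6; 17; 9; 5; 1; 23];
     [:: 21; 7; 3; 15; 1; 17; 18; 12; 22; 20; 0; 23];
     [:: 10; 21; 25; 16; 12; 9; 1; 6; 5; 19; 23; 7]].

Lemma covers_complete28 : covers 28 complete_rel complete28_blocks.
Proof. by vm_compute. Qed.

Definition complete37_blocks : seq (seq nat) :=
  develop [:: (0, 37)] 37
    [:: [:: 3; 9; 6; 25; 30; 13; 2; 29; 31; 19; 12; 27]].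

Lemma covers_complete37 : covers 37 complete_rel complete37_blocks.
Proof. by vm_compute. Qed.

(** The rotation has order 21. Its seventh power maps the last base block to itself, through an
    automorphism of order 3 of the Tietze graph, so this orbit has length 7: [5 * 21 + 7] blocks
    make up the 112 needed. *)
Definition complete64_blocks : seq (seq nat) :=
  develop [:: (0, 21); (21, 21); (42, 21); (63, 1)] 21
    [:: [:: 18; 56; 47; 34; 25; 46; 51; 17; 58; 39; 9; 6];
     [:: 53; 39; 12; 19; 27; 24; 56; 48; 4; 31; 51; 57];
     [:: 32; 51; 21; 41; 49; 34; 63; 1; 14; 6; 7; 54];
     [:: 11; 42; 59; 31; 35; 45; 3; 5; 0; 30; 38; 40];
     [:: 16; 45; 29; 52; 54; 8; 14; 5; 27; 33; 28; 18]] ++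
  develop [:: (0, 21); (21, 21); (42, 21); (63, 1)] 7
    [:: [:: 8; 36; 54; 15; 22; 61; 1; 29; 47; 51; 58; 44]].

Lemma covers_complete64 : covers 64 complete_rel complete64_blocks.
Proof. by vm_compute. Qed.

Definition complete73_blocks : seq (seq nat) :=
  develop [:: (0, 73)] 73
    [:: [:: 45; 36; 43; 55; 10; 30; 34; 48; 21; 67; 13; 68];
     [:: 12; 37; 20; 28; 54; 69; 36; 33; 56; 42; 63; 26]].

Lemma covers_complete73 : covers 73 complete_rel complete73_blocks.
Proof. by vm_compute. Qed.

(** Here and in the next three families all cycles below 24 have even length, so the rotation
    exchanges the even and the odd part and preserves [tripartite_rel]. *)
Definition tripartite9_blocks : seq (seq nat) :=
  develop [:: (0, 4); (4, 4); (8, 4); (12, 4); (16, 4); (20, 4); (24, 4); (28, 4); (32, 1)] 4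
    [:: [:: 28; 19; 20; 23; 26; 22; 1; 32; 10; 9; 12; 27];
     [:: 5; 20; 28; 17; 12; 29; 6; 7; 31; 22; 24; 3];
     [:: 13; 14; 24; 11; 2; 28; 8; 23; 29; 6; 26; 17];
     [:: 8; 11; 28; 3; 31; 20; 15; 18; 19; 7; 16; 32];
     [:: 17; 25; 7; 10; 3; 4; 13; 26; 2; 27; 15; 0]].

Lemma covers_tripartite9 : covers 33 tripartite_rel tripartite9_blocks.
Proof. by vm_compute. Qed.

Definition tripartite12_blocks : seq (seq nat) :=
  develop [:: (0, 24); (24, 12)] 24
    [:: [:: 33; 7; 18; 21; 28; 8; 3; 27; 10; 11; 24; 20]].

Lemma covers_tripartite12 : covers 36 tripartite_rel tripartite12_blocks.
Proof. by vm_compute. Qed.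

Definition tripartite21_blocks : seq (seq nat) :=
  develop [:: (0, 12); (12, 12); (24, 12); (36, 6); (42, 3)] 12
    [:: [:: 4; 35; 0; 27; 15; 6; 39; 17; 44; 29; 16; 21];
     [:: 21; 30; 2; 32; 8; 15; 29; 9; 38; 40; 14; 13];
     [:: 38; 0; 3; 18; 43; 11; 12; 29; 7; 10; 21; 31]].

Lemma covers_tripartite21 : covers 45 tripartite_rel tripartite21_blocks.
Proof. by vm_compute. Qed.

Definition tripartite24_blocks : seq (seq nat) :=
  develop [:: (0, 8); (8, 8); (16, 8); (24, 8); (32, 8); (40, 8)] 8
    [:: [:: 35; 19; 40; 21; 25; 22; 45; 15; 16; 2; 47; 17];
     [:: 13; 47; 10; 27; 4; 7; 33; 1; 31; 40; 8; 5];
     [:: 40; 12; 27; 19; 26; 13; 37; 17; 6; 2; 32; 23];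
     [:: 40; 1; 26; 20; 35; 0; 39; 2; 9; 4; 45; 21];
     [:: 37; 14; 21; 8; 38; 11; 25; 20; 9; 12; 28; 7]].

Lemma covers_tripartite24 : covers 48 tripartite_rel tripartite24_blocks.
Proof. by vm_compute. Qed.

(** * Blocks as sets of edges, and decompositions as designs *)

Lemma set2_inj (T : finType) (a b c d : T) :
  [set a; b] = [set c; d] -> (a = c /\ b = d) \/ (a = d /\ b = c).
Proof.
move=> /setP eqs.
have mem x : (x == a) || (x == b) = (x == c) || (x == d).
  by have := eqs x; rewrite !inE.
have := mem a; have := mem b; have := mem c; have := mem d; rewrite !eqxx ?orbT /=.
move=> /orP[]/eqP ? /orP[]/eqP ? /esym/orP[]/eqP ? /esym/orP[]/eqP ?;
  by [left; split; congruence | right; split; congruence].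
Qed.

Lemma card_set_seq (T : finType) (L : seq T) (P : pred T) :
  uniq L -> #|[set e in L | P e]| = count P L.
Proof.
move=> uL; rewrite -size_filter -(card_uniqP (filter_uniq P uL)).
by apply: eq_card => e; rewrite in_set mem_filter andbC.
Qed.

Definition block_seq (T : finType) (b : nat -> T) : seq {set T} :=
  [seq [set b p.1; b p.2] | p <- tietze_edge_list].

Lemma tietze_edge_list_range p :
  p \in tietze_edge_list ->
  [/\ p.1 \in iota 1 12, p.2 \in iota 1 12 & p.1 != p.2].
Proof.
move=> pin; have /allP/(_ p pin)/and3P[] : all (fun p =>
  [&& p.1 \in iota 1 12, p.2 \in iota 1 12 & p.1 != p.2]) tietze_edge_list by [].
by split.
Qed.

Lemma inord_iota k : k \in iota 1 12 -> (inord k : 'I_13) = k :> nat.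
Proof. by rewrite mem_iota => /andP[_ k13]; rewrite inordK. Qed.

Lemma inord_tietze_vertices k : k \in iota 1 12 -> inord k \in tietze_vertices.
Proof. by move=> kin; rewrite in_set inord_iota //; case: k kin. Qed.

(** No edge is listed in both directions, which makes the edges of a block pairwise different as
    sets. *)
Lemma tietze_edge_list_simple p q : p \in tietze_edge_list ->
  q \in tietze_edge_list -> p.1 = q.2 -> p.2 = q.1 -> False.
Proof.
move=> pin qin e1 e2.
have /allP/(_ p pin)/allP/(_ q qin) : all (fun p => all (fun q =>
  ~~ ((p.1 == q.2) && (p.2 == q.1))) tietze_edge_list) tietze_edge_list by [].
by rewrite e1 e2 !eqxx.
Qed.

Lemma tietze_degree k : k \in iota 1 12 ->
  count (fun p => (k == p.1) || (k == p.2)) tietze_edge_list = 3.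
Proof.
move=> kin; apply/eqP; move: k kin; apply/allP.
by [].
Qed.

Section Block.
Variables (T : finType) (b : nat -> T).
Hypothesis b_inj : {in iota 1 12 &, injective b}.

Lemma uniq_block_seq : uniq (block_seq b).
Proof.
rewrite map_inj_in_uniq // => p q pin qin.
have [p1 p2 _] := tietze_edge_list_range pin.
have [q1 q2 _] := tietze_edge_list_range qin.
case/set2_inj=> -[].
  move=> /(b_inj p1 q1) e1 /(b_inj p2 q2) e2.
  by rewrite [p]surjective_pairing e1 e2 -surjective_pairing.
by move=> /(b_inj p1 q2) e1 /(b_inj p2 q1) e2; case: (tietze_edge_list_simple pin qin).
Qed.

Lemma card_block_edges : #|[set e in block_seq b]| = 18.
Proof. by rewrite cardsE (card_uniqP uniq_block_seq) size_map. Qed.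

Lemma card_block_incident x :
  #|[set e in block_seq b | x \in e]| =
  count (fun p => (x == b p.1) || (x == b p.2)) tietze_edge_list.
Proof.
rewrite (card_set_seq _ uniq_block_seq) count_map; apply: eq_count => p.
by rewrite /= in_set2.
Qed.

(** The Tietze graph is cubic: a point has degree 3 in a block that contains it and degree 0
    otherwise. *)
Lemma block_degree x : 3 %| #|[set e in block_seq b | x \in e]|.
Proof.
rewrite card_block_incident.
case: (boolP (x \in [seq b k | k <- iota 1 12])) => [/mapP[k kin ->]|xout].
  have -> : count (fun p => (b k == b p.1) || (b k == b p.2)) tietze_edge_list =
      count (fun p => (k == p.1) || (k == p.2)) tietze_edge_list.
    apply: eq_in_count => p /tietze_edge_list_range[p1 p2 _].
    by rewrite !(inj_in_eq b_inj).
  by rewrite tietze_degree.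
rewrite (eq_in_count (a2 := pred0)) ?count_pred0 // => p.
move=> /tietze_edge_list_range[p1 p2 _]; apply: negbTE; rewrite negb_or.
by apply/andP; split; apply: contraNneq xout => ->; apply: map_f.
Qed.

End Block.

Lemma tietze_edges_mem (i j : 'I_13) :
  ([set i; j] \in tietze_edges) =
  ((val i, val j) \in tietze_edge_list) || ((val j, val i) \in tietze_edge_list).
Proof.
rewrite in_set; apply/mapP/orP.
  case=> p pin /set2_inj.
  have [p1 p2 _] := tietze_edge_list_range pin.
  by case=> -[-> ->]; [left|right]; rewrite /val /= !inord_iota // -surjective_pairing.
case=> pin; [exists (val i, val j) | exists (val j, val i)] => //.
  by rewrite /= !inord_val.
by rewrite /= !inord_val setUC.
Qed.

(** Isomorphism with [tietze] amounts to a labelling: this direction serves necessity,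
    [isomorphic_block_graph] serves sufficiency. *)
Lemma isomorphic_block (T : finType) (H : graph T) :
  isomorphic tietze H ->
  exists2 b : nat -> T, {in iota 1 12 &, injective b} &
    edges H = [set e in block_seq b].
Proof.
case=> f [f_inj fV fE]; exists (fun k => f (inord k)).
  move=> i j iin jin /f_inj eqij.
  by rewrite -(inord_iota iin) eqij ?inord_iota ?inord_tietze_vertices.
apply/setP => e; rewrite in_set; apply/idP/mapP.
  move=> eH; have [eV /eqP/cards2P[x [y [xy eE]]]] := edgesP eH.
  move: eH eV; rewrite eE subUset !sub1set -fV => eH.
  move=> /andP[/imsetP[i iV xi] /imsetP[j jV yj]].
  move: eH; rewrite xi yj fE // tietze_edges_mem => /orP[] pin.
    by exists (val i, val j) => //=; rewrite !inord_val.
  by exists (val j, val i) => //=; rewrite !inord_val setUC.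
case=> p pin ->; have [p1 p2 _] := tietze_edge_list_range pin.
rewrite fE ?inord_tietze_vertices // in_set.
by apply/mapP; exists p.
Qed.

Lemma block_edgesP (T : finType) (b : nat -> T) :
  {in iota 1 12 &, injective b} ->
  forall e, e \in [set e in block_seq b] ->
  e \subset [set b (val i) | i in tietze_vertices] /\ #|e| = 2.
Proof.
move=> b_inj e; rewrite in_set => /mapP[p pin ->].
have [p1 p2 p12] := tietze_edge_list_range pin.
split; last by rewrite cards2 (inj_in_eq b_inj) // p12.
rewrite subUset !sub1set; apply/andP; split; apply/imsetP.
  by exists (inord p.1); rewrite ?inord_tietze_vertices //= inord_iota.
by exists (inord p.2); rewrite ?inord_tietze_vertices //= inord_iota.
Qed.

Lemma isomorphic_block_graph (T : finType) (b : nat -> T)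
    (b_inj : {in iota 1 12 &, injective b}) :
  isomorphic tietze (Graph (block_edgesP b_inj)).
Proof.
have rng (i : 'I_13) : i \in tietze_vertices -> val i \in iota 1 12.
  by rewrite inE mem_iota /= => i0; rewrite i0 /= ltn_ord.
exists (fun i : 'I_13 => b (val i)); split=> //=.
  by move=> i j /rng iin /rng jin /(b_inj _ _ iin jin)/val_inj.
move=> i j /rng iin /rng jin; rewrite tietze_edges_mem in_set.
apply/mapP/orP => [[p pin]|].
  have [p1 p2 _] := tietze_edge_list_range pin.
  case/set2_inj=> -[].
    move=> /(b_inj _ _ iin p1) -> /(b_inj _ _ jin p2) ->.
    by left; rewrite -surjective_pairing.
  move=> /(b_inj _ _ iin p2) -> /(b_inj _ _ jin p1) ->.
  by right; rewrite -surjective_pairing.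
by case=> pin; [exists (val i, val j) | exists (val j, val i); rewrite // setUC].
Qed.

Lemma mem_block_arcs (T : finType) (b : nat -> T) x y :
  ([set x; y] \in block_seq b) = ((x, y) \in arcs b).
Proof.
apply/mapP/arcsP => -[p pin].
  case/set2_inj=> -[-> ->]; first by exists p => //; rewrite mem_cat pin.
  exists (p.2, p.1) => //; rewrite mem_cat; apply/orP; right.
  by apply/mapP; exists p.
case=> -> ->; move: pin; rewrite mem_cat => /orP[pin|/mapP[q qin ->]].
  by exists p.
by exists q => //; rewrite setUC.
Qed.

(** A count of at least 1 puts every edge into some block; a count of at most 1 makes different
    blocks disjoint. *)
Lemma decomposable_design n :
  decomposable (fun x y : 'I_n.+1 => (x != y) : nat) ->
  exists D : {set {set {set 'I_n.+1}}}, is_design tietze D.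
Proof.
case=> s [sok sE].
pose B (i : 'I_(size s)) := [set e in block_seq (nth (fun=> ord0) s i)].
have sE' x y : \sum_(i < size s) count_mem (x, y) (arcs (nth (fun=> ord0) s i)) = (x != y).
  by rewrite -sE (big_nth (fun=> ord0)) big_mkord.
have emb i : {in iota 1 12 &, injective (nth (fun=> ord0) s (i : 'I_(size s)))}.
  exact: embedding_inj (all_nthP _ sok i (ltn_ord i)).
have BE i e : e \in B i -> #|e| = 2.
  by move=> /(block_edgesP (emb i))[].
exists (B @: 'I_(size s)); split; last first.
  move=> A /imsetP[i _ ->]; exists (Graph (block_edgesP (emb i))); split=> //.
    split; first exact: subsetT.
    by apply/subsetP => e /BE e2; rewrite in_set e2.
  exact: isomorphic_block_graph.
apply/and3P; split.
- rewrite eqEsubset; apply/andP; split; apply/subsetP => e.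
    by case/bigcupP=> A /imsetP[i _ ->] /BE e2; rewrite in_set e2.
  rewrite in_set => /cards2P[x [y [xy ->]]].
  have : 0 < \sum_(i < size s) count_mem (x, y) (arcs (nth (fun=> ord0) s i)).
    by rewrite sE' xy.
  rewrite lt0n sum_nat_eq0 negb_forall => /existsP[i].
  rewrite implyTb -lt0n -has_count has_pred1 -mem_block_arcs => xyi.
  by apply/bigcupP; exists (B i); rewrite ?imset_f // in_set.
- apply/trivIsetP => A A' /imsetP[i _ ->] /imsetP[j _ ->] neq.
  have ij : i != j by apply: contraNneq neq => ->.
  rewrite -setI_eq0; apply/set0Pn => -[e]; rewrite in_setI => /andP[ei ej].
  have /eqP/cards2P[x [y [xy eE]]] := BE _ _ ei.
  move: ei ej; rewrite eE !in_set !mem_block_arcs -!has_pred1 !has_count => ei ej.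
  (* Two blocks through the same edge would make this sum, which is 1, at least 2. *)
  have := sE' x y; rewrite xy (bigD1 i) // (bigD1 j); last by rewrite eq_sym.
  by rewrite -[LHS]/(_ + (_ + _)) -(prednK ei) -(prednK ej) !addSn addnS.
- apply/imsetP => -[i _ /esym/eqP]; apply/negP; rewrite -card_gt0.
  by rewrite /B (card_block_edges (emb i)).
Qed.

(** * Necessary conditions on the order *)

Lemma design_card n (D : {set {set {set 'I_n}}}) :
  is_design tietze D -> 'C(n, 2) = #|D| * 18.
Proof.
case=> partD blockD; have /card_partition := partD.
rewrite card_draws card_ord => ->; rewrite -sum_nat_const; apply: eq_bigr => B BD.
have [H [_ /isomorphic_block[b b_inj bE] <-]] := blockD B BD.
by rewrite bE card_block_edges.
Qed.

(** Double counting of the edges at [ord0]: there are [n] in the complete graph of order [n.+1], and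
    each block contributes a multiple of 3. *)
Lemma design_degree n (D : {set {set {set 'I_n.+1}}}) :
  is_design tietze D -> 3 %| n.
Proof.
case=> partD blockD.
pose inc (A : {set {set 'I_n.+1}}) := [set e in A | ord0 \in e].
have nE : #|inc (edges (complete n.+1))| = n.
  have -> : inc (edges (complete n.+1)) =
      [set [set ord0; x] | x in [set~ ord0 : 'I_n.+1]].
    apply/setP => e; rewrite 2!in_set /=; apply/andP/imsetP.
      case=> /cards2P[x [y [xy ->]]]; rewrite in_set2 => /orP[]/eqP x0.
        by exists y; rewrite // ?in_setC1 x0 // eq_sym.
      by exists x; rewrite // ?in_setC1 ?x0 // setUC.
    case=> x; rewrite in_setC1 => x0 ->; split; last by rewrite set21.
    by rewrite cards2 [ord0 == x]eq_sym x0.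
  rewrite card_in_imset; first by rewrite cardsC1 card_ord.
  by move=> x y _ _ /set2_inj[[]//|[-> ->]].
suff : 3 %| #|inc (edges (complete n.+1))| by rewrite nE.
have -> : #|inc (edges (complete n.+1))| = \sum_(B in D) #|inc B|.
  rewrite -sum1_card.
  transitivity (\sum_(e in edges (complete n.+1) | ord0 \in e) 1).
    by apply: eq_bigl => e; rewrite in_set.
  rewrite big_mkcondr /= (set_partition_big _ partD) /=; apply: eq_bigr => B BD.
  by rewrite -big_mkcondr /= -sum1_card; apply: eq_bigl => e; rewrite in_set.
apply: dvdn_sum => B BD.
have [H [_ /isomorphic_block[b b_inj bE] <-]] := blockD B BD.
have -> : inc (edges H) = [set e in block_seq b | ord0 \in e].
  by apply/setP => e; rewrite bE !in_set.
exact: block_degree.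
Qed.

Lemma design_order n (D : {set {set {set 'I_n}}}) :
  0 < n -> is_design tietze D -> n = 1 %[mod 36] \/ n = 28 %[mod 36].
Proof.
case: n D => // n D _ desD.
move: (design_card desD) (design_degree desD); move: #|D| => d.
move=> + /dvdnP[k nE]; clear D desD; subst n.
rewrite bin2 /= => /(congr1 double); rewrite halfK oddM /= andNb subn0 => cd.
have {cd} : (k * 3).+1 * k = d * 12 by lia.
(* Modulo 12 the product [(3k + 1) k] vanishes only for [k = 0] and [k = 9], which gives the orders
   1 and 28 modulo 36. *)
have : k %% 12 < 12 by rewrite ltn_pmod.
rewrite {2 3 4 5}(divn_eq k 12); move: (k %/ 12) (k %% 12) => q.
by do 12![case=> [|] //; first lia].
Qed.

(** * Points and levels, and the pieces between and within groups *)

(** [None] is the point at infinity; [Some (x, i, j)] is point [j] on level [i] of group [x], and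
    the pair [(x, i)] names a level. *)
Definition point := option (nat * nat * nat).

Definition weight (a : nat) (u : nat * nat) : nat := if u.1 == 0 then a else 12.

Definition triple_rel (wt : nat * nat -> nat) (t : seq (nat * nat)) (P Q : point) : bool :=
  if (P, Q) is (Some (u, j), Some (v, k)) then
    [&& j < wt u, k < wt v, u \in t, v \in t & u != v]
  else false.

Lemma eq_triple_rel wt t t' P Q :
  t =i t' -> triple_rel wt t P Q = triple_rel wt t' P Q.
Proof. by case: P Q => [[u j]|] [[w k]|] // eqt; rewrite /triple_rel !eqt. Qed.

Lemma triple_decomposable (wt : nat * nat -> nat) (u1 u2 u3 : nat * nat) :
  uniq [:: u1; u2; u3] -> wt u1 = 12 -> wt u2 = 12 ->
  decomposable (fun x y => [&& x < 24 + wt u3, y < 24 + wt u3 & tripartite_rel x y] : nat) ->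
  decomposable (fun P Q => triple_rel wt [:: u1; u2; u3] P Q : nat).
Proof.
rewrite /= !inE negb_or => /and3P[/andP[n12 n13] n23 _] w1 w2.
(* The labels match [part]: even numbers below 24 go to [u1], odd ones to [u2], the rest to [u3],
   whose size is free. *)
pose f n : point := Some (if n < 24 then (if odd n then u2 else u1, n./2) else (u3, n - 24)).
apply: (decomposable_map (f := f) (D := fun n => n < 24 + wt u3)).
- move=> n m; rewrite /f /in_mem /= => nl ml.
  case: ltnP => n24; case: ltnP => m24; case no: (odd n); case mo: (odd m);
    move=> /(congr1 (odflt (u1, 0)))/eqP; rewrite xpair_eqE => /andP[/eqP eu /eqP en];
    try lia; by move: n12 n13 n23; rewrite eu eqxx.
- by move=> n m; case: ltnP => // ?; case: ltnP => // ?; lia.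
- have neqs := (negbTE n12, negbTE n13, negbTE n23,
    (eq_sym u2 u1, eq_sym u3 u1, eq_sym u3 u2)).
  move=> n m nl ml; rewrite /tripartite_rel nl ml /f /part /=; congr nat_of_bool.
  case: ltnP => n24; case: ltnP => m24; case no: (odd n); case mo: (odd m);
    rewrite /triple_rel ?w1 ?w2 !inE ?eqxx ?neqs ?orbT ?andbT ?andbF /=
      ?ltn_half_double ?ltn_subLR //;
    lia.
- case=> [[u j]|] [[v k]|]; rewrite /triple_rel ?eqb0 ?negbK //.
  case/and5P => ju kv ut vt uv.
  have pre p l : p \in [:: u1; u2; u3] -> l < wt p ->
      exists2 n, n < 24 + wt u3 & Some (p, l) = f n.
    rewrite !inE => /or3P[]/eqP ->; rewrite ?w1 ?w2 => ll.
    - exists l.*2; first lia.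
      by rewrite /f ifT ?odd_double ?doubleK //; lia.
    - exists l.*2.+1; first lia.
      by rewrite /f ifT /= ?odd_double ?uphalf_double //; lia.
    - exists (24 + l); first lia.
      by rewrite /f ltnNge leq_addr addKn.
  have [n nl nE] := pre u j ut ju; have [m ml mE] := pre v k vt kv.
  by exists n, m.
Qed.

(** Infinity belongs to every group, so that its edges are covered along with those inside the
    groups. *)
Definition group_pred (w x : nat) (P : point) : bool :=
  if P is Some (y, i, j) then [&& y == x, i < 3 & j < w] else true.

Lemma group_decomposable w x : 0 < w ->
  decomposable (fun n m => [&& n < 3 * w + 1, m < 3 * w + 1 & complete_rel n m] : nat) ->
  decomposable (fun P Q => [&& group_pred w x P, group_pred w x Q & P != Q] : nat).
Proof.
move=> w0.
(* Label 0 is infinity; otherwise quotient and remainder of the predecessor by [w] give the level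
   and the point on it. *)
pose f n : point := if n is m.+1 then Some (x, m %/ w, m %% w) else None.
have f_inj : injective f.
  by case=> [|n] [|m] //= [e1 e2]; rewrite (divn_eq n w) (divn_eq m w) e1 e2.
have fG n : n < 3 * w + 1 -> group_pred w x (f n).
  by case: n => [//|n] nl; rewrite /= eqxx ltn_pmod // ltn_divLR //; lia.
apply: (decomposable_map (f := f) (D := fun n => n < 3 * w + 1)).
- by move=> n m _ _ /f_inj.
- by move=> n m; case: ltnP => // ?; case: ltnP => // ?; lia.
- by move=> n m nl ml; rewrite !fG // nl ml /complete_rel (inj_eq f_inj).
- move=> P Q; rewrite eqb0 negbK => /and3P[PG QG _].
  have pre R : group_pred w x R -> exists2 n, n < 3 * w + 1 & R = f n.
    case: R => [[[y i] j]|] /=; last by exists 0 => //; lia.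
    case/and3P=> /eqP -> i3 jw; exists (i * w + j).+1; first nia.
    by rewrite /f divnMDl // divn_small // addn0 modnMDl modn_small.
  have [n nl nE] := pre P PG; have [m ml mE] := pre Q QG.
  by exists n, m.
Qed.

(** * Bose's triples on three levels *)

(* Bose's triples: [z] is the midpoint of [x] and [y] modulo the odd number [v]. *)
Definition bose_triple (v x y z : nat) : bool :=
  (x < y) && [|| z.*2 == x + y, z.*2 == x + y + v | z.*2 + v == x + y].

Definition bose_vertices (k x y z : nat) : seq (nat * nat) :=
  [:: (x, k); (y, k); (z, k.+1 %% 3)].

Section Bose.
Variable h : nat.
Let v := h.*2.+1.

Lemma bose_triple_uniq x y z : x < v -> y < v -> z < v -> bose_triple v x y z ->
  [/\ x != y, x != z & y != z].
Proof. rewrite /bose_triple /v => *; split; lia. Qed.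

(** If [i = j], then [k = i] and [p], [q] are [x], [y] in increasing order, with a single midpoint
    as [v] is odd. Otherwise one of [p], [q] is the midpoint, and reflecting the other in it gives
    the third group. *)
Lemma bose_unique (p i q j k x y z k' x' y' z' : nat) :
  k < 3 -> x < v -> y < v -> z < v -> bose_triple v x y z ->
  k' < 3 -> x' < v -> y' < v -> z' < v -> bose_triple v x' y' z' -> p != q ->
  (p, i) \in bose_vertices k x y z -> (q, j) \in bose_vertices k x y z ->
  (p, i) \in bose_vertices k' x' y' z' -> (q, j) \in bose_vertices k' x' y' z' ->
  [/\ k = k', x = x', y = y' & z = z'].
Proof.
rewrite /bose_triple /v !inE !xpair_eqE.
move=> k3 xv yv zv t k3' xv' yv' zv' t' pq.
move=> /or3P[]/andP[/eqP ? /eqP ?] /or3P[]/andP[/eqP ? /eqP ?]; subst;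
move=> /or3P[]/andP[/eqP ? /eqP ?] /or3P[]/andP[/eqP ? /eqP ?]; subst;
  split; lia.
Qed.

Lemma bose_exists_level p q i j : p < v -> q < v -> i < 3 -> p != q ->
  (j = i) \/ (j = i.+1 %% 3) ->
  exists k x y z, [/\ k < 3, [&& x < v, y < v & z < v], bose_triple v x y z,
    (p, i) \in bose_vertices k x y z & (q, j) \in bose_vertices k x y z].
Proof.
rewrite /bose_triple /bose_vertices /v => pv qv i3 pq [] ->.
  (* On one level the triple consists of [p], [q] and their midpoint; an odd sum becomes even by
     adding or subtracting the odd [v]. *)
  pose s := p + q.
  exists i, (minn p q), (maxn p q),
    (if odd s then if s < v then (s + v)./2 else (s - v)./2 else s./2).
  rewrite !inE !xpair_eqE /s /v; split=> //; case: ifP => so; try case: ifP => sv; lia.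
(* On consecutive levels [q] is the midpoint, and [r] is the reflection [2q - p] of [p] in [q],
   reduced modulo [v]. *)
pose r := if q.*2 < p then q.*2 + v - p else if q.*2 - p < v then q.*2 - p else q.*2 - p - v.
have [rv rp rq] : [/\ r < v, r != p &
    [|| q.*2 == p + r, q.*2 == p + r + v | q.*2 + v == p + r]].
  by rewrite /r /v; split; do ?case: ifP => ?; lia.
exists i, (minn p r), (maxn p r), q.
move: rv rp rq; rewrite /v {}/r; move: (if _ then _ else _) => r.
by rewrite !inE !xpair_eqE !eqxx; split=> //; lia.
Qed.

Lemma bose_exists p q i j : p < v -> q < v -> i < 3 -> j < 3 -> p != q ->
  exists k x y z, [/\ k < 3, [&& x < v, y < v & z < v], bose_triple v x y z,
    (p, i) \in bose_vertices k x y z & (q, j) \in bose_vertices k x y z].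
Proof.
move=> pv qv i3 j3 pq.
(* Two levels modulo 3 are equal or one follows the other; the last case exchanges the roles of [p]
   and [q]. *)
have [] : (j = i \/ j = i.+1 %% 3) \/ i = j.+1 %% 3 by lia.
  exact: bose_exists_level.
move=> ij; have := @bose_exists_level q p j i qv pv j3.
rewrite eq_sym => /(_ pq (or_intror ij)) [k [x [y [z [? ? ? ? ?]]]]].
by exists k, x, y, z.
Qed.

(** For [p <> q] this is existence with uniqueness; for [p = q] the sum vanishes since the three
    groups of a triple are distinct. *)
Lemma bose_count p q i j : p < v -> q < v -> i < 3 -> j < 3 ->
  \sum_(t : 'I_3 * ('I_v * 'I_v * 'I_v) | bose_triple v t.2.1.1 t.2.1.2 t.2.2)
    [&& (p, i) \in bose_vertices t.1 t.2.1.1 t.2.1.2 t.2.2,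
        (q, j) \in bose_vertices t.1 t.2.1.1 t.2.1.2 t.2.2 &
        (p, i) != (q, j)] = (p != q).
Proof.
move=> pv qv i3 j3; case: (eqVneq p q) => [<-|pq].
  rewrite big1 // => -[k [[x y] z]] /= t; apply/eqP; rewrite eqb0; apply/negP.
  have [xy xz yz] := bose_triple_uniq (ltn_ord x) (ltn_ord y) (ltn_ord z) t.
  rewrite !inE !xpair_eqE eqxx /= => /and3P[A B].
  by move: A B xy xz yz => /or3P[]/andP[/eqP -> /eqP ->] /or3P[]/andP[/eqP e /eqP ->];
    rewrite ?e ?eqxx.
have [k [x [y [z [k3 /and3P[xv yv zv] t pin qin]]]]] := bose_exists pv qv i3 j3 pq.
rewrite (bigD1 (Ordinal k3, (Ordinal xv, Ordinal yv, Ordinal zv))) //= pin qin xpair_eqE.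
rewrite (negbTE pq) /= big1 // => -[k' [[x' y'] z']] /= /andP[t' neq].
apply/eqP; rewrite eqb0; apply: contra neq => /and3P[pin' qin' _].
have [e1 e2 e3 e4] := bose_unique (ltn_ord k') (ltn_ord x') (ltn_ord y') (ltn_ord z') t'
  k3 xv yv zv t pq pin' qin' pin qin.
by apply/eqP; congr (_, (_, _, _)); apply: val_inj.
Qed.

End Bose.

(** * Assembling the complete graph on all points *)

Definition point_pred (a v : nat) (P : point) : bool :=
  if P is Some (x, i, j) then [&& x < v, i < 3 & j < weight a (x, i)] else true.

Lemma bose_decomposable a h : 0 < a ->
  decomposable (fun x y => [&& x < 24 + a, y < 24 + a & tripartite_rel x y] : nat) ->
  decomposable (fun x y => [&& x < 3 * a + 1, y < 3 * a + 1 & complete_rel x y] : nat) ->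
  decomposable (fun P Q : point =>
    [&& point_pred a h.*2.+1 P, point_pred a h.*2.+1 Q & P != Q] : nat).
Proof.
move=> a0 trip_a comp_a; pose v := h.*2.+1.
have trip_12 := covers_decomposable covers_tripartite12.
have comp_12 := covers_decomposable covers_complete37.
have blocks : decomposable (fun P Q : point =>
    \sum_(t : 'I_3 * ('I_v * 'I_v * 'I_v) | bose_triple v t.2.1.1 t.2.1.2 t.2.2)
      triple_rel (weight a) (bose_vertices t.1 t.2.1.1 t.2.1.2 t.2.2) P Q).
  apply: decomposable_sum => -[k [[x y] z]] /= t.
  have [xy xz yz] := bose_triple_uniq (ltn_ord x) (ltn_ord y) (ltn_ord z) t.
  have ltxy : x < y by case/andP: t.
  (* A level of group 0 must come third, where the size is free. As [x < y], group 0 can only be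
     [x], and then the triple is rotated, or [z], which is third already. *)
  have [x0|x0] := eqVneq (x : nat) 0.
    apply: (@eq_decomposable _ (fun P Q => triple_rel (weight a)
        [:: (y : nat, k : nat); (z : nat, k.+1 %% 3); (x : nat, k : nat)] P Q : nat)).
      by move=> P Q; congr nat_of_bool; apply: eq_triple_rel => u;
        rewrite -(mem_rot 1 (bose_vertices _ _ _ _)).
    apply: triple_decomposable; rewrite /weight /= ?x0 //.
    - by rewrite !inE !xpair_eqE; lia.
    - by rewrite ifF //; lia.
    - by rewrite ifF //; lia.
  apply: triple_decomposable; rewrite /weight /=.
  - by rewrite !inE !xpair_eqE; lia.
  - by rewrite ifF //; lia.
  - by rewrite ifF //; lia.
  - by case: ifP.
have groups : decomposable (fun P Q : point => \sum_(x < v)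
    [&& group_pred (weight a (x : nat, 0)) x P,
        group_pred (weight a (x : nat, 0)) x Q & P != Q]).
  apply: decomposable_sum => x _; apply: group_decomposable; rewrite /weight /=.
    by case: ifP.
  by case: ifP.
(* Every finite point in range lies in exactly one group; this yields the edges to infinity. *)
have single p i j : \sum_(x < v) group_pred (weight a (x : nat, 0)) x (Some (p, i, j)) =
    point_pred a v (Some (p, i, j)) :> nat.
  have [pv|vp] := ltnP p v.
    rewrite (bigD1 (Ordinal pv)) //= eqxx pv big1 ?addn0 // => x.
    by rewrite -val_eqE /= eq_sym => /negPf ->.
  rewrite /point_pred ltnNge vp big1 // => x _.
  by rewrite /= gtn_eqF // (leq_trans (ltn_ord x)).
apply: eq_decomposable (decomposableD blocks groups) => -[[[p i] j]|] [[[q l] m]|].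
- rewrite /triple_rel /=.
  case: (boolP [&& p < v, i < 3 & j < weight a (p, i)]) => [/and3P[pv i3 ja]|out]; last first.
    rewrite !big1 // => [x _|[k [[x y] z]] /= _]; apply/eqP; rewrite eqb0; apply: contra out.
      by move=> /and3P[/and3P[/eqP -> -> ->] _ _]; rewrite ltn_ord.
    case/and5P=> -> _ + _ _; rewrite !inE !xpair_eqE => pin.
    move: (ltn_ord k) (ltn_ord x) (ltn_ord y) (ltn_ord z); rewrite -/v; lia.
  case: (boolP [&& q < v, l < 3 & m < weight a (q, l)]) => [/and3P[qv l3 ma]|out]; last first.
    rewrite !big1 // => [x _|[k [[x y] z]] /= _]; apply/eqP; rewrite eqb0; apply: contra out.
      by move=> /and3P[_ /and3P[/eqP -> -> ->] _]; rewrite ltn_ord.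
    case/and5P=> _ -> _ + _; rewrite !inE !xpair_eqE => pin.
    move: (ltn_ord k) (ltn_ord x) (ltn_ord y) (ltn_ord z); rewrite -/v; lia.
  (* The triples count a pair of points once if the groups differ and never if they agree; [groups]
     does the opposite for distinct points. *)
  rewrite ja ma /= (bose_count pv qv i3 l3).
  have [e|pq] := eqVneq p q.
    rewrite (bigD1 (Ordinal pv)) //= big1 => [|x].
      by rewrite addn0 -e eqxx i3 l3 ja; move: ma; rewrite -e => ->.
    by rewrite -val_eqE /= eq_sym => /negPf ->.
  rewrite big1 => [|x _]; last first.
    by case: eqP => //= e; case: eqP => //= e'; [move: pq; rewrite e e' eqxx | rewrite andbF].
  by rewrite addn0; case: eqP => // -[e]; rewrite e eqxx in pq.
- rewrite big1 // add0n /= andbT -single; apply: eq_bigr => x _.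
  by rewrite /= andbT.
- rewrite big1 // add0n /= andbT -single; apply: eq_bigr => x _.
  by rewrite /= andbT.
- by rewrite !big1 // => *; rewrite eqxx.
Qed.

(** * Numbering the points, and the resulting designs *)

Definition vertex_grid (v : nat) : seq (nat * nat) :=
  [seq (x, i) | x <- iota 0 v, i <- iota 0 3].

Definition points (a v : nat) : seq point :=
  None :: [seq Some (u, j) | u <- vertex_grid v, j <- iota 0 (weight a u)].

Lemma mem_vertex_grid v x i : ((x, i) \in vertex_grid v) = (x < v) && (i < 3).
Proof.
apply/allpairsP/andP => [[[y l] [yv l3 [-> ->]]]|[xv i3]].
  by split; [move: yv | move: l3]; rewrite mem_iota.
by exists (x, i); rewrite !mem_iota.
Qed.

Lemma uniq_vertex_grid v : uniq (vertex_grid v).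
Proof. by rewrite allpairs_uniq ?iota_uniq // => -[? ?] [? ?] _ _ [-> ->]. Qed.

Lemma mem_points a v P : (P \in points a v) = point_pred a v P.
Proof.
rewrite inE; case: P => [[[x i] j]|] //=.
rewrite andbA -mem_vertex_grid; apply/allpairsPdep/andP.
  by case=> u [k [uin ka [-> ->]]]; move: ka; rewrite mem_iota; split.
by case=> uin ja; exists (x, i), j; rewrite mem_iota.
Qed.

Lemma uniq_points a v : uniq (points a v).
Proof.
rewrite /= allpairs_uniq_dep ?uniq_vertex_grid ?andbT //.
- by apply/allpairsPdep => -[? [? []]].
- by move=> u _; apply: iota_uniq.
- by move=> [u j] [w k] _ _ /= [] -> ->.
Qed.

Lemma size_points a h : size (points a h.*2.+1) = h * 72 + 3 * a + 1.
Proof.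
rewrite /points -cat1s size_cat size_allpairs_dep sumnE big_map big_allpairs_dep.
have -> : \sum_(x <- iota 0 h.*2.+1) \sum_(i <- iota 0 3) size (iota 0 (weight a (x, i))) =
    \sum_(0 <= x < h.*2.+1) 3 * weight a (x, 0).
  rewrite /index_iota subn0; apply: eq_bigr => x _.
  by rewrite !big_cons big_nil !size_iota /weight /=; lia.
(* Group 0 has [3a] points and each of the other [2h] groups has 36. *)
rewrite big_nat_recl // (eq_bigr (fun=> 36)) // sum_nat_const_nat /weight /=; lia.
Qed.

Lemma bose_design a h : 0 < a ->
  decomposable (fun x y => [&& x < 24 + a, y < 24 + a & tripartite_rel x y] : nat) ->
  decomposable (fun x y => [&& x < 3 * a + 1, y < 3 * a + 1 & complete_rel x y] : nat) ->
  exists D : {set {set {set 'I_(h * 72 + 3 * a).+1}}}, is_design tietze D.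
Proof.
move=> a0 trip_a comp_a; apply: decomposable_design.
have dec := bose_decomposable h a0 trip_a comp_a.
(* A point is renamed to its position in the list [points]. *)
pose f P : 'I_(h * 72 + 3 * a).+1 := inord (index P (points a h.*2.+1)).
have szE : size (points a h.*2.+1) = (h * 72 + 3 * a).+1 by rewrite size_points addn1.
have fE P : point_pred a h.*2.+1 P -> f P = index P (points a h.*2.+1) :> nat.
  by move=> PS; rewrite inordK // -szE index_mem mem_points.
have f_inj : {in point_pred a h.*2.+1 &, injective f}.
  move=> P Q PS QS /(congr1 val); rewrite /= !fE // => /(congr1 (nth None (points a h.*2.+1))).
  by rewrite !nth_index ?mem_points.
apply: (decomposable_map f_inj) dec.
- by move=> P Q; rewrite eqb0 negbK => /and3P[-> ->].
- by move=> P Q PS QS; rewrite PS QS (inj_in_eq f_inj).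
- have pre (x : 'I_(h * 72 + 3 * a).+1) : exists2 P, point_pred a h.*2.+1 P & x = f P.
    have xl : x < size (points a h.*2.+1) by rewrite szE.
    exists (nth None (points a h.*2.+1) x); first by rewrite -mem_points mem_nth.
    by apply: val_inj; rewrite /= fE ?index_uniq ?uniq_points // -mem_points mem_nth.
  by move=> x y _; have [P PS xE] := pre x; have [Q QS yE] := pre y; exists P, Q.
Qed.

Theorem theorem1 (n : nat) (n_gt0 : 0 < n) :
  (exists D : {set {set {set 'I_n}}}, is_design tietze D) <->
  (n = 1 %[mod 36] \/ n = 28 %[mod 36]).
Proof.
split=> [[D]|]; first exact: design_order.
have tri9 := covers_decomposable covers_tripartite9.
have tri12 := covers_decomposable covers_tripartite12.
have tri21 := covers_decomposable covers_tripartite21.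
have tri24 := covers_decomposable covers_tripartite24.
have comp28 := covers_decomposable covers_complete28.
have comp37 := covers_decomposable covers_complete37.
have comp64 := covers_decomposable covers_complete64.
have comp73 := covers_decomposable covers_complete73.
move=> n_mod; have : n = 1 \/ exists h,
    [\/ n = (h * 72 + 3 * 9).+1, n = (h * 72 + 3 * 12).+1, n = (h * 72 + 3 * 21).+1 |
        n = (h * 72 + 3 * 24).+1].
  (* As [v = 2h + 1], the orders grow in steps of 72, starting from 28, 37, 64 and 73 for the four
     values of [a]; so the residues are split modulo 72. *)
  have : [\/ n %% 72 = 1, n %% 72 = 28, n %% 72 = 37 | n %% 72 = 64].
    by case: n_mod => ?; [case: (ltnP (n %% 72) 36) => ?; [apply: Or41|apply: Or43] |
                          case: (ltnP (n %% 72) 36) => ?; [apply: Or42|apply: Or44]]; lia.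
  case=> r.
  (* Residue 1 starts at 73, not at 1: hence the predecessor of the quotient, and the separate case
     [n = 1]. *)
  - have [->|n1] := eqVneq n 1; [by left|right; exists (n %/ 72).-1; apply: Or44; lia].
  - by right; exists (n %/ 72); apply: Or41; lia.
  - by right; exists (n %/ 72); apply: Or42; lia.
  - by right; exists (n %/ 72); apply: Or43; lia.
case=> [->|[h [] ->]].
- apply: decomposable_design; apply: eq_decomposable (decomposable0 _) => x y.
  by rewrite !ord1 eqxx.
- exact: bose_design.
- exact: bose_design.
- exact: bose_design.
- exact: bose_design.
Qed.
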